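(* Let $n\ge 1$, let $0=t_0<t_1<\cdots<t_n<t_{n+1}=1$, let $\alpha>0$ and $\beta$ be real constants, and let $w:[0,1]\to\mathbb{R}$ be continuous. Suppose that $v$ solves the penalized maximum log-likelihood problem $$\min_{v}\ -\frac{1}{\alpha}\sum_{i=1}^n v(t_i)+\frac12\int_0^1\left[\beta^2\,(v(t)-w(t))^2+\dot v^2(t)\right]dt\quad\text{subject to}\quad \int_0^1 e^{v(t)}\,dt=1,$$ where the minimization is over $v\in W^{1,\infty}(0,1;\mathbb{R})$. Then there exist a real constant $\gamma$ and a function $z:[0,1]\to\mathbb{R}$ such that $v$ (together with $z$ and $\gamma$) solves the following two-point boundary-value problem with interior jump conditions: $$\dot z(t)=e^{v(t)},\qquad z(0)=0,\quad z(1)=1,$$ $$\ddot v(t)=\beta^2\,(v(t)-w(t))+\gamma\,e^{v(t)},\qquad \dot v(0)=0,\quad \dot v(1)=0,$$ $$\dot v(t_j^+)=\dot v(t_j^-)-\frac1\alpha,\qquad j=1,\ldots,n,$$ where the differential equations hold for all $t\in(t_i,t_{i+1})$, $i=0,\ldots,n$.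
   Context: The points $t_1,\dots,t_n$ are given sample points. The estimated probability density is $f_v(t)=e^{v(t)}/\int_0^1 e^{v(\tau)}\,d\tau$, which equals $e^{v(t)}$ under the normalization constraint $\int_0^1 e^{v}=1$. Dots denote derivatives with respect to $t$; $\dot v(t_j^\pm)$ denote the one-sided limits of $\dot v$ at $t_j$, and $\dot v(0),\dot v(1)$ are one-sided. A solution $v$ of the boundary-value problem is understood to be continuous on $[0,1]$ and twice differentiable on each open interval $(t_i,t_{i+1})$, with one-sided limits of $\dot v$ at the endpoints of these intervals; $z$ is continuous on $[0,1]$. *)

(* Defs.v *)
From HB Require Import structures.
From mathcomp Require Import all_boot all_order.
From mathcomp Require Import ssralg ssrnum ssrint interval.
From mathcomp Require Import all_classical all_reals all_analysis.
Import Order.TTheory GRing.Theory Num.Theory.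
Import numFieldTopology.Exports numFieldNormedType.Exports.

Set Implicit Arguments.
Unset Strict Implicit.
Unset Printing Implicit Defensive.

Local Open Scope classical_set_scope.
Local Open Scope ring_scope.

(* Functions on [0, 1] are represented by total functions [R -> R], whose values
   outside [0, 1] never matter. *)

Definition test_function (R : realType) (phi : R -> R) : Prop :=
  [/\ forall x, derivable phi x 1,
      continuous phi^`(),
      compact (closure [set x | phi x != 0]) &
      closure [set x | phi x != 0] `<=` `]0, 1[%classic].

(* Membership in L^oo(0, 1), through the extension by 0; only measurability on
   ]0, 1[ and the essential supremum of |f| over ]0, 1[ are constrained. *)
Definition Linfty01 (R : realType) (f : R -> R) : Prop :=
  (f \_ `]0, 1[%classic) \in Lfun (@lebesgue_measure R) +oo%E.

(* [v] belongs to W^{1,oo}(0, 1) and [dv] is its weak derivative (unique up to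
   null sets). An element of the Sobolev space is a class modulo null sets; as
   point values are needed, [v] is its continuous representative on [0, 1]. *)
Definition W1infty (R : realType) (v dv : R -> R) : Prop :=
  [/\ {within `[0, 1], continuous v},
      Linfty01 v,
      Linfty01 dv &
      forall phi : R -> R, test_function phi ->
        \int[lebesgue_measure]_(x in `]0, 1[) (v x * phi^`() x) =
        - \int[lebesgue_measure]_(x in `]0, 1[) (dv x * phi x)].

(* The sample points are [t 1], ..., [t n]; the values of [t] beyond [n.+1]
   never matter. *)
Definition sample_grid (R : realType) (n : nat) (t : nat -> R) : Prop :=
  [/\ t 0%N = 0, t n.+1 = 1 & forall i, (i <= n)%N -> t i < t i.+1].

Definition pml_objective (R : realType) (n : nat) (t : nat -> R)
    (alpha beta : R) (w v dv : R -> R) : R :=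
  - (alpha^-1 * \sum_(1 <= i < n.+1) v (t i)) +
  2^-1 * \int[lebesgue_measure]_(x in `[0, 1])
           (beta ^+ 2 * (v x - w x) ^+ 2 + dv x ^+ 2).

Definition normalized (R : realType) (v : R -> R) : Prop :=
  \int[lebesgue_measure]_(x in `[0, 1]) expR (v x) = 1.

Definition pml_solution (R : realType) (n : nat) (t : nat -> R)
    (alpha beta : R) (w v : R -> R) : Prop :=
  exists dv : R -> R,
    [/\ W1infty v dv,
        normalized v &
        forall u du : R -> R, W1infty u du -> normalized u ->
          pml_objective n t alpha beta w v dv <=
          pml_objective n t alpha beta w u du].

(* The boundary values of the derivative of [v] are one-sided difference-quotient
   derivatives; by [bvp_limits] and the mean value theorem they are also the
   one-sided limits of [v^`()] at 0 and 1. *)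
Record bvp_solution (R : realType) (n : nat) (t : nat -> R) (alpha beta : R)
    (w v z : R -> R) (gamma : R) : Prop := BvpSolution {
  bvp_continuous_v : {within `[0, 1], continuous v} ;
  bvp_continuous_z : {within `[0, 1], continuous z} ;
  bvp_limits : forall i, (i <= n)%N ->
    cvg (v^`() @ (t i)^'+) /\ cvg (v^`() @ (t i.+1)^'-) ;
  bvp_ode_z : forall i, (i <= n)%N -> forall s, t i < s < t i.+1 ->
    derivable z s 1 /\ z^`() s = expR (v s) ;
  bvp_ode_v : forall i, (i <= n)%N -> forall s, t i < s < t i.+1 ->
    [/\ derivable v s 1, derivable v^`() s 1 &
        v^`(2) s = beta ^+ 2 * (v s - w s) + gamma * expR (v s)] ;
  bvp_z0 : z 0 = 0 ;
  bvp_z1 : z 1 = 1 ;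
  bvp_dv0 : h^-1 * (v h - v 0) @[h --> 0^'+] --> (0 : R) ;
  bvp_dv1 : h^-1 * (v (1 + h) - v 1) @[h --> 0^'-] --> (0 : R) ;
  bvp_jump : forall j, (1 <= j <= n)%N ->
    lim (v^`() @ (t j)^'+) = lim (v^`() @ (t j)^'-) - alpha^-1
}.

(* Main.v *)
(* Perturb the minimizer v into v + s phi - c(s), where phi is C^1 and
   c(s) = ln (int e^(v + s phi)) restores the constraint.  By Jensen's inequality
   and a second order bound, c(s) = s m + O(s^2) with m = int (e^v phi), so the
   first variation vanishes and reads, with A = v - w and
   gamma = n / alpha - beta^2 int A,
     int (v' phi') + int ((beta^2 A + gamma e^v) phi)
       = alpha^-1 sum_i phi(t_i).
   Taking phi' = psi to be a test function turns int (v' psi) into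
   - int (v psi'), so the weak derivative disappears.  The same weak equation
   holds for V(x) = P(x) - alpha^-1 sum_i max(0, x - t_i), where
   P'' = beta^2 A + gamma e^v and P'(0) = 0; the value of gamma is exactly what
   makes P'(1) = n / alpha.  Hence v - V is constant by the du Bois-Reymond lemma,
   and V solves the boundary value problem by construction. *)

Require Import Defs.
From HB Require Import structures.
From mathcomp Require Import all_boot all_order.
From mathcomp Require Import ssralg ssrnum ssrint interval.
From mathcomp Require Import all_classical all_reals all_analysis.
From mathcomp Require Import measurable_realfun ess_sup_inf ring lra.
Import Order.TTheory GRing.Theory Num.Theory.
Import numFieldTopology.Exports numFieldNormedType.Exports.

Local Open Scope classical_set_scope.
Local Open Scope ring_scope.

Set Implicit Arguments.
Unset Strict Implicit.

(** * Fundamental theorem of calculus and primitives of continuous functions *)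

Section calculus.
Context {R : realType}.
Local Notation mu := (@lebesgue_measure R).
Implicit Types (f g F G : R -> R) (a b x : R).

Lemma continuous_integrable f a b : {within `[a, b], continuous f} ->
  mu.-integrable `[a, b] (EFin \o f).
Proof. exact/continuous_compact_integrable/segment_compact. Qed.

Lemma is_derive_within_continuous F f a b :
  (forall x, a <= x <= b -> is_derive x 1 F (f x)) ->
  {within `[a, b], continuous F}.
Proof.
move=> dF; apply: continuous_in_subspaceT => x /set_mem /=; rewrite in_itv/= => xab.
have := dF _ xab; case=> /derivable1_diffP dFx _.
exact: differentiable_continuous.
Qed.

Lemma is_derive_oo_LRcontinuous F f a b : a < b ->
  (forall x, a <= x <= b -> is_derive x 1 F (f x)) ->
  derivable_oo_LRcontinuous F a b /\ {in `]a, b[, F^`() =1 f}.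
Proof.
move=> ab dF.
have /(continuous_within_itvP _ ab)[_ Fa Fb] := is_derive_within_continuous dF.
have {}dF x : x \in `]a, b[ -> is_derive x 1 F (f x).
  by rewrite in_itv/= => /andP[ax xb]; apply: dF; rewrite !ltW.
split; first split => //.
  by move=> x /dF [].
by move=> x /dF xF; rewrite derive1E derive_val.
Qed.

Lemma Rintegral_is_derive F f a b : a < b -> {within `[a, b], continuous f} ->
  (forall x, a <= x <= b -> is_derive x 1 F (f x)) ->
  \int[mu]_(x in `[a, b]) f x = F b - F a.
Proof.
move=> ab cf dF; have [Fab F'f] := is_derive_oo_LRcontinuous ab dF.
by rewrite /Rintegral (continuous_FTC2 ab cf Fab F'f).
Qed.

Lemma Rintegral_is_derive_by_parts F G f g a b : a < b ->
  {within `[a, b], continuous f} -> {within `[a, b], continuous g} ->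
  (forall x, a <= x <= b -> is_derive x 1 F (f x)) ->
  (forall x, a <= x <= b -> is_derive x 1 G (g x)) ->
  \int[mu]_(x in `[a, b]) (F x * g x) =
  F b * G b - F a * G a - \int[mu]_(x in `[a, b]) (f x * G x).
Proof.
move=> ab cf cg dF dG; have [Fab F'f] := is_derive_oo_LRcontinuous ab dF.
have [Gab G'g] := is_derive_oo_LRcontinuous ab dG.
exact: Rintegration_by_parts.
Qed.

(** For y near x the partial integral from a to y lies between 0 and the total integral, which is 0.
    It is thus locally zero, and its derivative at x is [f x]. *)
Lemma Rintegral_cc_eq0 f a b x : continuous f ->
  (forall y, a <= y <= b -> 0 <= f y) -> \int[mu]_(y in `[a, b]) f y = 0 ->
  a < x < b -> f x = 0.
Proof.
move=> cf f0 intf0 /andP[ax xb].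
have fi c d : mu.-integrable `[c, d] (EFin \o f).
  by apply: continuous_integrable; exact: continuous_subspaceT.
have [_ <-] := @continuous_FTC1_closed R f a x b xb (fi a b) ax (cf x).
rewrite derive1E -(near_eq_derive _ (f := cst 0)) ?derive_cst//.
near=> y; have ay : a < y by near: y; exact: lt_nbhsr.
have yb : y < b by near: y; exact: lt_nbhsl.
apply/esym/eqP; rewrite eq_le /=; apply/andP; split; last first.
  apply: Rintegral_ge0 => z /=; rewrite in_itv/= => /andP[az zy].
  by apply: f0; rewrite az (le_trans zy)// ltW.
rewrite -intf0 -subr_ge0 Rintegral_itvB ?bnd_simp//; [|exact: ltW..].
apply: Rintegral_ge0 => z /=; rewrite in_itv/= => /andP[yz zb].
by apply: f0; rewrite zb andbT ltW// (lt_trans ay).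
Unshelve. all: by end_near. Qed.

(* The base point -1 makes [prim f] two-sided differentiable on [0, 1]. *)
Definition prim f x : R := \int[mu]_(y in `[-1, x]) f y.

Lemma is_derive_prim f x : continuous f -> -1 < x -> is_derive x 1 (prim f) (f x).
Proof.
move=> cf x1; have xx1 : x < x + 1 by rewrite ltrDl.
have fi : mu.-integrable `[-1, x + 1] (EFin \o f).
  by apply: continuous_integrable; exact: continuous_subspaceT.
have [dp <-] := continuous_FTC1_closed xx1 fi x1 (cf x).
by rewrite derive1E; exact: derivableP.
Qed.

Lemma prim_eq0 f x : (forall y, y <= x -> f y = 0) -> prim f x = 0.
Proof.
move=> f0; rewrite /prim (@eq_Rintegral _ _ _ mu _ (cst 0)) ?Rintegral_cst ?mul0r//.
by move=> y /set_mem/=; rewrite in_itv/= => /andP[_ yx]; rewrite f0.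
Qed.

(** Left of 0 the primitive of such an f is identically zero, which settles the points at or below
    the base point -1. A test function must be derivable on the whole line. *)
Lemma is_derive_prim_supp f x : continuous f -> (forall y, y <= 0 -> f y = 0) ->
  is_derive x 1 (prim f) (f x).
Proof.
move=> cf f0; have [x1|x1] := ltP (-1) x; first exact: is_derive_prim.
have x0 : x < 0 by rewrite (le_lt_trans x1)// ltrN10.
rewrite f0 ?ltW//; apply: (near_eq_is_derive _ (f := cst 0)).
near=> y; rewrite prim_eq0// => z zy; apply: f0; rewrite (le_trans zy)// ltW//.
by near: y; exact: lt_nbhsl.
Unshelve. all: by end_near. Qed.

End calculus.

(** * The du Bois-Reymond lemma *)

Section du_bois_reymond.
Context {R : realType}.
Local Notation mu := (@lebesgue_measure R).
Implicit Types (f g h : R -> R) (a b c e x y : R).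

Lemma Rintegral_prim f a b : continuous f -> -1 < a -> a < b ->
  \int[mu]_(x in `[a, b]) f x = prim f b - prim f a.
Proof.
move=> cf a1 ab; apply: Rintegral_is_derive => //.
  exact: continuous_subspaceT.
by move=> x /andP[ax _]; apply: is_derive_prim => //; exact: lt_le_trans ax.
Qed.

(** The primitive is 0 left of e and constant right of 1 - e, where the constant is the total
    integral 0. Its support therefore lies in [[e, 1 - e]], a compact subset of []0, 1[]. *)
Lemma test_function_prim h e : 0 < e < 1 -> continuous h ->
  (forall x, x <= e -> h x = 0) -> (forall x, 1 - e <= x -> h x = 0) ->
  \int[mu]_(x in `[0, 1]) h x = 0 ->
  test_function (prim h) /\ (prim h)^`() = h.
Proof.
move=> /andP[e0 e1] ch hl hr inth0.
have dh x : is_derive x 1 (prim h) (h x).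
  by apply: is_derive_prim_supp => // y y0; apply: hl; rewrite (le_trans y0)// ltW.
have h'E : (prim h)^`() = h.
  by apply/funext => x; rewrite derive1E; have [_] := dh x.
have priml x : x <= e -> prim h x = 0.
  by move=> xe; apply: prim_eq0 => y yx; apply: hl; exact: le_trans xe.
have prim1 : prim h 1 = 0.
  by rewrite -inth0 Rintegral_prim ?ltrN10// [prim h 0]priml ?subr0// ltW.
have primc x : 1 - e <= x -> prim h x = prim h (1 - e).
  rewrite le_eqVlt => /predU1P[<-//|ex].
  apply/eqP; rewrite -subr_eq0 -Rintegral_prim//; last by lra.
  rewrite (@eq_Rintegral _ _ _ mu _ (cst 0)) ?Rintegral_cst ?mul0r//.
  by move=> y /set_mem/=; rewrite in_itv/= => /andP[ey _]; rewrite hr.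
have primr x : 1 - e <= x -> prim h x = 0.
  by move=> ex; rewrite primc// -(primc 1) ?prim1//; lra.
have supp : closure [set x | prim h x != 0] `<=` `[e, 1 - e]%classic.
  rewrite [X in _ `<=` X](closure_id _).1; last exact: interval_closed.
  apply: closureS => x /= /eqP hx0; rewrite in_itv/= !leNgt; apply/andP; split.
    by apply/negP => xe; apply: hx0; rewrite priml// ltW.
  by apply/negP => xe; apply: hx0; rewrite primr// ltW.
split=> //; split.
- by move=> x; have [] := dh x.
- by rewrite h'E.
- by apply: subclosed_compact supp; [exact: closed_closure|exact: segment_compact].
- move=> x /supp /=; rewrite !in_itv/= => /andP[ex xe]; apply/andP; split; lra.
Qed.

(* With a weight eta >= 0 vanishing outside ]e, 1 - e[ and c the eta-mean of f,
   h = (f - c) eta has mean 0, hence is the derivative of a test function, and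
   int (f h) = 0 becomes int ((f - c)^2 eta) = 0. *)
Lemma weak_derivative0_cst_oo f e : continuous f -> 0 < e < 2^-1 ->
  (forall psi, test_function psi ->
    \int[mu]_(x in `[0, 1]) (f x * psi^`() x) = 0) ->
  exists c, forall x, e < x < 1 - e -> f x = c.
Proof.
move=> cf /andP[e0 e2] fpsi.
have e1 : 0 < e < 1 by apply/andP; split; lra.
pose eta x := Num.max 0 (Num.min (x - e) (1 - e - x)).
have ceta : continuous eta.
  move=> x; apply: (@continuous_max R R (cst 0) (fun x => Num.min (x - e) (1 - e - x))).
    exact: cvg_cst.
  apply: (@continuous_min R R (fun x => x - e) (fun x => 1 - e - x)).
    by apply: cvgB; [exact: cvg_id|exact: cvg_cst].
  by apply: cvgB; [exact: cvg_cst|exact: cvg_id].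
have eta_ge0 x : 0 <= eta x by rewrite /eta le_max lexx.
have eta_gt0 x : e < x < 1 - e -> 0 < eta x.
  by move=> /andP[ex xe]; rewrite /eta lt_max lt_min; apply/orP; right; apply/andP; split; lra.
have eta0l x : x <= e -> eta x = 0.
  by move=> xe; apply/max_idPl; rewrite ge_min; apply/orP; left; lra.
have eta0r x : 1 - e <= x -> eta x = 0.
  by move=> xe; apply/max_idPl; rewrite ge_min; apply/orP; right; lra.
have int_cont g : continuous g -> mu.-integrable `[0, 1] (EFin \o g).
  by move=> cg; apply: continuous_integrable; exact: continuous_subspaceT.
pose m := \int[mu]_(x in `[0, 1]) eta x.
have m0 : m != 0.
  apply/eqP => m0; have : 0 < eta 2^-1 by apply: eta_gt0; apply/andP; split; lra.
  rewrite (@Rintegral_cc_eq0 _ eta 0 1 2^-1) ?ltxx//.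
  by apply/andP; split; lra.
have cfeta : continuous (f \* eta) by move=> x; apply: cvgM; [exact: cf|exact: ceta].
pose c := m^-1 * \int[mu]_(x in `[0, 1]) (f x * eta x).
pose h x := f x * eta x - c * eta x.
have ch : continuous h.
  move=> x; apply: cvgB; first exact: cfeta.
  by apply: cvgM; [exact: cvg_cst|exact: ceta].
have inth0 : \int[mu]_(x in `[0, 1]) h x = 0.
  rewrite /h RintegralB//; [|exact: int_cont|]; last first.
    apply: int_cont => x; apply: cvgM; [exact: cvg_cst|exact: ceta].
  by rewrite RintegralZl//; [rewrite -/m /c mulrAC mulVf// mul1r subrr|exact: int_cont].
have [] := @test_function_prim h e e1 ch.
- by move=> x xe; rewrite /h eta0l// !mulr0 subrr.
- by move=> x xe; rewrite /h eta0r// !mulr0 subrr.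
- by [].
move=> /fpsi + h'E; rewrite h'E => fh0.
exists c => x xe.
pose g x := (f x - c) ^+ 2 * eta x.
have cg : continuous g.
  move=> y; apply: cvgM; last exact: ceta.
  by apply: (cvg_comp _ (fun y => y ^+ 2));
    [apply: cvgB; [exact: cf|exact: cvg_cst]|exact: exprn_continuous].
have intg0 : \int[mu]_(x in `[0, 1]) g x = 0.
  have -> : \int[mu]_(x in `[0, 1]) g x =
            \int[mu]_(x in `[0, 1]) (f x * h x - c * h x).
    by apply: eq_Rintegral => y _; rewrite /g /h; ring.
  rewrite RintegralB//; last 2 first.
  - by apply: int_cont => y; apply: cvgM; [exact: cf|exact: ch].
  - by apply: int_cont => y; apply: cvgM; [exact: cvg_cst|exact: ch].
  by rewrite fh0 RintegralZl ?inth0 ?mulr0 ?subrr//; exact: int_cont.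
have /eqP : g x = 0.
  apply: (@Rintegral_cc_eq0 _ g 0 1) => //; last by apply/andP; split; lra.
  by move=> y _; rewrite /g mulr_ge0// sqr_ge0.
by rewrite mulf_eq0 sqrf_eq0 subr_eq0 (gt_eqF (eta_gt0 x xe)) orbF => /eqP.
Qed.

(* The du Bois-Reymond lemma. *)
Lemma weak_derivative0_cst f : continuous f ->
  (forall psi, test_function psi ->
    \int[mu]_(x in `[0, 1]) (f x * psi^`() x) = 0) ->
  forall x, 0 <= x <= 1 -> f x = f 0.
Proof.
move=> cf fpsi.
have foo x : 0 < x < 1 -> f x = f 2^-1.
  (* Half the distance from x to the boundary: both x and 1/2 then lie strictly between e and 1 - e,
     so they share the same constant. *)
  move=> /andP[x0 x1]; pose e := Num.min x (1 - x) / 2.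
  have [ex ex'] : Num.min x (1 - x) <= x /\ Num.min x (1 - x) <= 1 - x.
    by rewrite !ge_min !lexx orbT.
  have m0 : 0 < Num.min x (1 - x) by rewrite lt_min x0 subr_gt0.
  have [|c fc] := @weak_derivative0_cst_oo f e cf _ fpsi.
    by rewrite /e; apply/andP; split; lra.
  by rewrite !fc// /e; apply/andP; split; lra.
(* The two endpoints follow by continuity, f being constant on the open interval. *)
have f0 : f 0 = f 2^-1.
  apply: (@cvg_unique _ _ (f @ (0 : R)^'+)) => //.
    by apply: cvg_at_right_filter; exact: cf.
  apply: cvg_near_cst; near=> x; apply: foo; apply/andP; split.
    by near: x; exact: nbhs_right_gt.
  by near: x; exact: nbhs_right_lt.
have f1 : f 1 = f 2^-1.
  apply: (@cvg_unique _ _ (f @ (1 : R)^'-)) => //.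
    by apply: cvg_at_left_filter; exact: cf.
  apply: cvg_near_cst; near=> x; apply: foo; apply/andP; split.
    by near: x; exact: nbhs_left_gt.
  by near: x; exact: nbhs_left_lt.
move=> x /andP[]; rewrite le_eqVlt => /predU1P[<-//|x0].
rewrite le_eqVlt f0 => /predU1P[->//|x1].
by apply: foo; rewrite x0.
Unshelve. all: by end_near. Qed.

End du_bois_reymond.

(** * Essentially bounded functions on (0, 1) and their integrals *)

Section Linfty01.
Context {R : realType}.
Local Notation mu := (@lebesgue_measure R).
Implicit Types (f g : R -> R) (M c x : R).

Let I01 : set R := `]0, 1[%classic.

Let mI01 : measurable I01. Proof. exact: measurable_itv. Qed.

Lemma Linfty01P f : Linfty01 f <-> measurable_fun I01 f /\
  exists M, {ae mu, forall x, I01 x -> `|f x| <= M}.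
Proof.
have mu_gt0 : (0 < mu [set: R])%E by rewrite -set_itvNyy lebesgue_measure_itv/= ltry.
have nE : abse \o (EFin \o (f \_ I01)) = EFin \o (Num.norm \o (f \_ I01)).
  by apply/funext => x.
split=> [/andP[/set_mem/= mf /set_mem/=]|[mf [M fM]]].
  rewrite /finite_norm unlock mu_gt0 nE => /ess_supr_bounded[M fM].
  split; first by apply/(measurable_restrictT _ _).2.
  exists M; apply: filterS fM => x /= + Ix.
  by rewrite patchE mem_set.
apply/andP; split; apply/mem_set => /=.
  by apply/(measurable_restrictT _ _).1.
rewrite /finite_norm unlock mu_gt0 nE.
(* Taking the maximum with 0 makes the bound cover the extension by 0 as well. *)
apply: (@le_lt_trans _ _ (Num.max 0 M)%:E); last exact: ltry.
apply/ess_supP; apply: (@filterS _ _ (ae_filter_ringOfSetsType mu)) fM => x /= fxM.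
rewrite lee_fin patchE; case: ifPn => [/set_mem/fxM|_]; rewrite le_max ?normr0 ?lexx//.
by move=> ->; rewrite orbT.
Qed.

Lemma Linfty01D f g : Linfty01 f -> Linfty01 g -> Linfty01 (fun x => f x + g x).
Proof.
move=> /Linfty01P[mf [M fM]] /Linfty01P[mg [N gN]]; apply/Linfty01P; split.
  exact: measurable_funD.
exists (M + N).
by apply: (@filterS2 _ _ (ae_filter_ringOfSetsType mu)) fM gN => x fM gN Ix /=;
  rewrite (le_trans (ler_normD _ _))// lerD ?fM ?gN.
Qed.

Lemma Linfty01M f g : Linfty01 f -> Linfty01 g -> Linfty01 (fun x => f x * g x).
Proof.
move=> /Linfty01P[mf [M fM]] /Linfty01P[mg [N gN]]; apply/Linfty01P; split.
  exact: measurable_funM.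
exists (M * N).
by apply: (@filterS2 _ _ (ae_filter_ringOfSetsType mu)) fM gN => x fM gN Ix /=;
  rewrite normrM ler_pM ?fM ?gN.
Qed.

Lemma continuous_bounded01 f : {within `[0, 1], continuous f} ->
  exists M, forall x, 0 <= x <= 1 -> `|f x| <= M.
Proof.
move=> cf; have /compact_bounded[M [_ fM]] :=
  continuous_compact cf (@segment_compact R 0 1).
exists (M + 1) => x x01; apply: (fM (M + 1)); first by rewrite ltrDl.
by exists x => //=; rewrite in_itv.
Qed.

Lemma continuous_Linfty01 f : {within `[0, 1], continuous f} -> Linfty01 f.
Proof.
move=> cf; apply/Linfty01P; split.
  have mf : measurable_fun `[(0 : R), 1] f.
    exact: subspace_continuous_measurable_fun.
  by apply: measurable_funS mf => //; exact: subset_itvW.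
have [M fM] := continuous_bounded01 cf; exists M; apply: aeW => x.
by rewrite /I01/= in_itv/= => /andP[x0 x1]; rewrite fM// !ltW.
Qed.

Lemma Linfty01_cst c : Linfty01 (fun=> c).
Proof. by apply/continuous_Linfty01/continuous_subspaceT => x; exact: cvg_cst. Qed.

(** [Linfty01] does not constrain the values at 0 and 1, but two points affect neither measurability
    nor the integral of the absolute value. *)
Lemma Linfty01_integrable f : Linfty01 f -> mu.-integrable `[0, 1] (EFin \o f).
Proof.
move=> /Linfty01P[mf [M fM]].
have mf01 : measurable_fun `[(0 : R), 1] f.
  exact: measurable_fun_itv_cc mf.
apply/integrableP; split; first exact/measurable_EFinP.
rewrite -integral_itv_obnd_cbnd; last first.
  apply: measurableT_comp => //; apply/measurable_EFinP.
  by apply: measurable_funS mf01 => // x /=; rewrite !in_itv/= => /andP[/ltW ->].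
rewrite -integral_itv_bndo_bndc; last first.
  by do 2 apply: measurableT_comp => //.
apply: (@le_lt_trans _ _ (\int[mu]_(x in I01) (Num.max 0 M)%:E)%E).
  apply: ae_ge0_le_integral => //=.
  - by do 2 apply: measurableT_comp => //.
  - by move=> x _; rewrite lee_fin le_max lexx.
  apply: (@filterS _ _ (ae_filter_ringOfSetsType mu)) fM => x fM Ix.
  by rewrite lee_fin le_max fM// orbT.
rewrite integral_cst//= lebesgue_measure_itv/= lte_fin ltr01.
by rewrite -EFinB -EFinM ltry.
Qed.

(** Links weak derivatives, defined by integrals over the open interval, with the objective and
    integration by parts, which use the closed one. *)
Lemma Rintegral_oo01 f : Linfty01 f ->
  \int[mu]_(x in `]0, 1[) f x = \int[mu]_(x in `[0, 1]) f x.
Proof.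
move=> /Linfty01_integrable fi.
rewrite Rintegral_itv_bndo_bndc ?Rintegral_itv_obnd_cbnd//.
  by apply: integrableS fi => // x /=; rewrite !in_itv/= => /andP[/ltW ->].
by apply: integrableS fi => //; exact: subset_itvW.
Qed.

Lemma Rintegral01D f g : Linfty01 f -> Linfty01 g ->
  \int[mu]_(x in `[0, 1]) (f x + g x) =
  \int[mu]_(x in `[0, 1]) f x + \int[mu]_(x in `[0, 1]) g x.
Proof. by move=> *; rewrite RintegralD//; exact: Linfty01_integrable. Qed.

Lemma Rintegral01Z f c : Linfty01 f ->
  \int[mu]_(x in `[0, 1]) (c * f x) = c * \int[mu]_(x in `[0, 1]) f x.
Proof. by move=> *; rewrite RintegralZl//; exact: Linfty01_integrable. Qed.

Lemma Rintegral01_cst c : \int[mu]_(_ in `[0, 1]) c = c.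
Proof.
rewrite Rintegral_cst//= lebesgue_measure_itv/= lte_fin ltr01.
by rewrite -EFinB/= subr0 mulr1.
Qed.

Lemma le_Rintegral01 f g : Linfty01 f -> Linfty01 g ->
  (forall x, 0 <= x <= 1 -> f x <= g x) ->
  \int[mu]_(x in `[0, 1]) f x <= \int[mu]_(x in `[0, 1]) g x.
Proof.
move=> /Linfty01_integrable fi /Linfty01_integrable gi fg.
by apply: le_Rintegral => // x /=; rewrite in_itv => /fg.
Qed.

End Linfty01.

(** * Test functions and weak derivatives *)

Section test_functions.
Context {R : realType}.
Local Notation mu := (@lebesgue_measure R).
Implicit Types (v dv psi theta p r : R -> R) (c x : R).

Lemma test_functionP psi : test_function psi ->
  [/\ continuous psi, continuous psi^`(),
      forall x, is_derive x 1 psi (psi^`() x),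
      forall x, x <= 0 -> psi x = 0 & forall x, 1 <= x -> psi x = 0].
Proof.
move=> [dpsi cdpsi _ supp].
have supp0 x : psi x != 0 -> 0 < x < 1.
  move=> psix0; have /supp : closure [set x | psi x != 0] x by exact: subset_closure.
  by rewrite /= in_itv.
split=> // x.
- by apply: differentiable_continuous; exact/derivable1_diffP.
- by rewrite derive1E; exact: derivableP.
- by move=> x0; apply: contraTeq x0 => /supp0/andP[]; rewrite -ltNge.
- by move=> x1; apply: contraTeq x1 => /supp0/andP[]; rewrite -ltNge.
Qed.

Lemma is_derive_continuous p r : (forall x, is_derive x 1 p (r x)) -> continuous p.
Proof.
move=> dp x; have [dpx _] := dp x.
by apply: differentiable_continuous; exact/derivable1_diffP.
Qed.

Lemma is_derive_prim_test psi x : test_function psi ->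
  is_derive x 1 (prim psi) (psi x).
Proof. by move=> /test_functionP[cpsi _ _ psi0 _]; exact: is_derive_prim_supp. Qed.

Lemma W1infty_weak_derivative v dv theta : W1infty v dv -> test_function theta ->
  \int[mu]_(x in `[0, 1]) (v x * theta^`() x) =
  - \int[mu]_(x in `[0, 1]) (dv x * theta x).
Proof.
move=> [_ Lv Ldv weak] ttheta; have [ctheta cdtheta _ _ _] := test_functionP ttheta.
rewrite -!Rintegral_oo01 ?weak//; apply: Linfty01M => //.
  exact/continuous_Linfty01/continuous_subspaceT.
exact/continuous_Linfty01/continuous_subspaceT.
Qed.

(** The classical derivative r of p is also its weak derivative: integrate by parts, the boundary
    terms vanishing because test functions are 0 at 0 and 1. *)
Lemma W1inftyD_C1 v dv p r : W1infty v dv -> continuous r ->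
  (forall x, is_derive x 1 p (r x)) ->
  W1infty (fun x => v x + p x) (fun x => dv x + r x).
Proof.
move=> Wv cr dp; have cp := is_derive_continuous dp; have [cv Lv Ldv _] := Wv.
have Lp : Linfty01 p by exact/continuous_Linfty01/continuous_subspaceT.
have Lr : Linfty01 r by exact/continuous_Linfty01/continuous_subspaceT.
split; [|exact: Linfty01D|exact: Linfty01D|].
  move=> x; apply: (@continuousD _ R^o (subspace `[(0 : R), 1])); first exact: cv.
  by apply: continuous_subspaceT.
move=> theta ttheta; have [ctheta cdtheta dtheta thetal thetar] := test_functionP ttheta.
have Ltheta : Linfty01 theta by exact/continuous_Linfty01/continuous_subspaceT.
have Ldtheta : Linfty01 theta^`() by exact/continuous_Linfty01/continuous_subspaceT.
rewrite !Rintegral_oo01; [|by apply: Linfty01M => //; exact: Linfty01D..].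
under eq_Rintegral do rewrite mulrDl.
under [in RHS]eq_Rintegral do rewrite mulrDl.
rewrite !Rintegral01D; [|exact: Linfty01M..].
rewrite (W1infty_weak_derivative Wv ttheta).
rewrite (@Rintegral_is_derive_by_parts _ p theta r)//; [|exact: continuous_subspaceT..].
by rewrite (thetal 0)// (thetar 1)// !mulr0 subrr sub0r opprD.
Qed.

End test_functions.

(** * Second order estimates for the first variation *)

Section first_variation.
Context {R : realType}.
Local Notation mu := (@lebesgue_measure R).
Implicit Types (v dv w psi p r : R -> R) (x : R).

(** From 1 - x <= e^(-x) one gets e^x <= 1 / (1 - x). The right-hand side times 1 - x is 1 + x^2 (1
    - 2x), which is at least 1 when x <= 1/2. *)
Lemma expR_le1Dx2 (x : R) : x <= 2^-1 -> expR x <= 1 + x + 2 * x ^+ 2.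
Proof.
move=> x2; have := expR_ge1Dx (- x); rewrite expRN => h.
have ex0 : 0 < expR x := expR_gt0 x.
have : (1 - x) * expR x <= 1 by rewrite -ler_pdivlMr// div1r.
have -> : 1 + x + 2 * x ^+ 2 = (1 + x ^+ 2 * (1 - 2 * x)) / (1 - x) by field; lra.
rewrite ler_pdivlMr; last lra.
rewrite mulrC => /le_trans; apply; rewrite lerDl mulr_ge0 ?sqr_ge0//; lra.
Qed.

(** Since e^v is a probability density, m is the mean of p under it, and ln N is its log-partition
    function: Jensen bounds it below by m, and a quadratic bound on the exponential limits the
    excess. *)
Lemma log_partition_bounds v p (K : R) : K <= 2^-1 ->
  {within `[0, 1], continuous v} -> {within `[0, 1], continuous p} ->
  \int[mu]_(x in `[0, 1]) expR (v x) = 1 ->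
  (forall x, 0 <= x <= 1 -> `|p x| <= K) ->
  let m := \int[mu]_(x in `[0, 1]) (expR (v x) * p x) in
  let N := \int[mu]_(x in `[0, 1]) expR (v x + p x) in
  [/\ 0 < N, `|m| <= K & m <= ln N <= m + 2 * K ^+ 2].
Proof.
move=> K2 cv cp v1 pK m N.
have cexp (f : R -> R) : {within `[0, 1], continuous f} ->
    {within `[0, 1], continuous (fun x => expR (f x))}.
  by move=> cf x; apply: continuous_comp; [exact: cf|exact: continuous_expR].
have Lev : Linfty01 (fun x => expR (v x)) by exact/continuous_Linfty01/cexp.
have Lp : Linfty01 p by exact: continuous_Linfty01.
have Lc c : Linfty01 (fun=> c : R) by exact: Linfty01_cst.
have Levp : Linfty01 (fun x => expR (v x + p x)).
  apply/continuous_Linfty01/cexp => x.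
  by apply: (@continuousD _ R^o (subspace `[(0 : R), 1])); [exact: cv|exact: cp].
have linE a b : \int[mu]_(x in `[0, 1]) (a * expR (v x) + b * (expR (v x) * p x)) = a + b * m.
  rewrite Rintegral01D ?Rintegral01Z ?v1 ?mulr1//.
  - exact: Linfty01M.
  - by apply: Linfty01M.
  - by apply: Linfty01M => //; exact: Linfty01M.
have linL a b : Linfty01 (fun x => a * expR (v x) + b * (expR (v x) * p x)).
  by apply: Linfty01D; apply: Linfty01M => //; exact: Linfty01M.
(* Jensen's inequality by the tangent of the exponential at m: e^p >= e^m (1 + p - m), integrated
   against e^v. *)
have mN : expR m <= N.
  have -> : expR m = (1 - m) * expR m + expR m * m by ring.
  rewrite -linE; apply: le_Rintegral01 => // x x01; rewrite expRD.
  have := expR_ge1Dx (p x - m); rewrite expRD expRN ler_pdivlMr ?expR_gt0// => h.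
  rewrite [leLHS](_ : _ = expR (v x) * ((1 + (p x - m)) * expR m)); last by ring.
  by rewrite ler_pM2l ?expR_gt0.
have NK : N <= 1 + m + 2 * K ^+ 2.
  have -> : 1 + m + 2 * K ^+ 2 = (1 + 2 * K ^+ 2) + 1 * m by ring.
  rewrite -linE; apply: le_Rintegral01 => // x x01; rewrite expRD.
  have := pK x x01; rewrite ler_norml => /andP[pl pr].
  have := @expR_le1Dx2 (p x) (le_trans pr K2).
  have := expR_gt0 (v x).
  have : (p x) ^+ 2 <= K ^+ 2 by nra.
  nra.
have N0 : 0 < N by exact: lt_le_trans (expR_gt0 m) mN.
split=> //.
  (* The zero coefficients put both sides in the shape of [linE], so that -K e^v <= e^v p can be
     compared pointwise. *)
  have lo : - K + 0 * m <= 0 + 1 * m.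
    rewrite -(linE (- K) 0) -(linE 0 1); apply: le_Rintegral01 => // x x01.
    have := pK x x01; rewrite ler_norml => /andP[pl pr].
    have := expR_gt0 (v x); nra.
  have hi : 0 + 1 * m <= K + 0 * m.
    rewrite -(linE 0 1) -(linE K 0); apply: le_Rintegral01 => // x x01.
    have := pK x x01; rewrite ler_norml => /andP[pl pr].
    have := expR_gt0 (v x); nra.
  by rewrite ler_norml; lra.
apply/andP; split; first by rewrite -ler_expR lnK.
(* Here ln N <= N - 1 is combined with [NK]. *)
have := expR_ge1Dx (ln N); rewrite lnK//; lra.
Qed.

(** If L were nonzero, s = - e L with small e > 0 would give e L^2 (e C - 1) < 0. *)
Lemma quadratic_ge0_linear0 (L C d : R) : 0 < d ->
  (forall s, `|s| <= d -> 0 <= s * L + C * s ^+ 2) -> L = 0.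
Proof.
move=> d0 h; apply/eqP; apply: contraT => L0.
have nL : 0 < `|L| by rewrite normr_gt0.
pose D := `|C| + 1; have D0 : 0 < D by rewrite /D ltr_wpDl.
(* The first bound keeps |s| <= d; the second gives e C <= 1/2. *)
pose e := Num.min (d / `|L|) (D^-1 / 2).
have e0 : 0 < e by rewrite lt_min !divr_gt0// invr_gt0.
have ed : e * `|L| <= d by rewrite -ler_pdivlMr// ge_min lexx.
have eD : e * D <= 2^-1.
  by rewrite -ler_pdivlMr// mulrC ge_min lexx orbT.
have := h (- (e * L)); rewrite normrN normrM (gtr0_norm e0) => /(_ ed).
have CD : C <= D by rewrite /D (le_trans (ler_norm C))// lerDl.
have L2 : 0 < L ^+ 2 by rewrite exprn_even_gt0.
have -> : - (e * L) * L + C * (- (e * L)) ^+ 2 = e * L ^+ 2 * (e * C - 1) by ring.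
have : e * C <= 2^-1 by apply: le_trans eD; rewrite ler_pM2l.
move=> eC; have : 0 < e * L ^+ 2 by rewrite mulr_gt0.
nra.
Qed.

End first_variation.

(** * Comparison of the minimizer with a normalized perturbation *)

Section euler_lagrange.
Context {R : realType}.
Local Notation mu := (@lebesgue_measure R).
Implicit Types (v dv w psi p r : R -> R) (alpha beta K x : R) (t : nat -> R).

(** This is the first order coefficient of c in the objective when v is replaced by v - c, so it
    weighs the shift that restores the constraint. *)
Definition multiplier n alpha beta w v : R :=
  n%:R / alpha - beta ^+ 2 * \int[mu]_(x in `[0, 1]) (v x - w x).

Lemma sample_grid_homo n t : sample_grid n t ->
  forall i j, (i < j)%N -> (j <= n.+1)%N -> t i < t j.
Proof.
move=> [_ _ tS] i; elim=> // j IH; rewrite ltnS leq_eqVlt => /predU1P[-> jn|ij jn].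
  exact: tS.
by rewrite (lt_trans (IH ij (ltnW jn)))// tS.
Qed.

Lemma sample_grid_itv n t i : sample_grid n t -> (i <= n.+1)%N -> 0 <= t i <= 1.
Proof.
move=> gt; have [t0 t1 _] := gt; have h := sample_grid_homo gt => ile.
rewrite -t0 -t1; apply/andP; split.
  by case: i ile => // i ile; rewrite ltW// h.
by move: ile; rewrite leq_eqVlt => /predU1P[->//|ile]; rewrite ltW// h.
Qed.

(** The competitor is v + p - c with c = ln N. Its objective is expanded to first order, where c
    appears with factor gamma and is replaced by m. K measures the size of the perturbation, and the
    last term gathers all second order errors. *)
Lemma pml_perturbation n t alpha beta w v dv p r K :
  sample_grid n t -> {within `[0, 1], continuous w} -> W1infty v dv ->
  normalized v ->
  (forall u du : R -> R, W1infty u du -> normalized u ->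
    pml_objective n t alpha beta w v dv <= pml_objective n t alpha beta w u du) ->
  continuous r -> (forall x, is_derive x 1 p (r x)) -> K <= 2^-1 ->
  (forall x, 0 <= x <= 1 -> `|p x| <= K) ->
  (forall x, 0 <= x <= 1 -> `|r x| <= K) ->
  forall gamma, gamma = multiplier n alpha beta w v ->
  0 <= - (alpha^-1 * \sum_(1 <= i < n.+1) p (t i)) +
       \int[mu]_(x in `[0, 1])
         ((beta ^+ 2 * (v x - w x) + gamma * expR (v x)) * p x) +
       \int[mu]_(x in `[0, 1]) (dv x * r x) +
       (2 * `|gamma| + 2^-1 * (9 * beta ^+ 2 + 1)) * K ^+ 2.
Proof.
move=> gt cw Wv v1 vmin cr dp K2 pK rK gamma gammaE.
have cp := is_derive_continuous dp.
have [cv Lv Ldv _] := Wv.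
have cpw : {within `[0, 1], continuous p} by exact: continuous_subspaceT.
pose m := \int[mu]_(x in `[0, 1]) (expR (v x) * p x).
pose N := \int[mu]_(x in `[0, 1]) expR (v x + p x); pose c := ln N.
have [N0 mK /andP[mc cm]] : [/\ 0 < N, `|m| <= K & m <= c <= m + 2 * K ^+ 2].
  exact: (log_partition_bounds K2 cv cpw v1 pK).
have dpc x : is_derive x 1 (fun x => p x - c) (r x).
  by have := dp x => ?; apply: is_derive_eq; rewrite subr0.
have Wu := W1inftyD_C1 Wv cr dpc.
have Lp : Linfty01 p by exact: continuous_Linfty01.
have Lr : Linfty01 r by exact/continuous_Linfty01/continuous_subspaceT.
have Lw : Linfty01 w by exact: continuous_Linfty01.
have Lc := @Linfty01_cst R.
have LN f : Linfty01 f -> Linfty01 (fun x => - f x).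
  by move=> Lf; under eq_fun do rewrite -mulN1r; exact: Linfty01M.
have Lev : Linfty01 (fun x => expR (v x)).
  by apply/continuous_Linfty01 => x; apply: continuous_comp; [exact: cv|exact: continuous_expR].
have u1 : normalized (fun x => v x + (p x - c)).
  rewrite /normalized; under eq_Rintegral do rewrite addrA expRD mulrC.
  rewrite Rintegral01Z; last first.
    apply/continuous_Linfty01 => x; apply: continuous_comp; last exact: continuous_expR.
    by apply: (@continuousD _ R^o (subspace `[(0 : R), 1])); [exact: cv|exact: cpw].
  by rewrite expRN lnK -/N// mulVf// gt_eqF.
have := vmin _ _ Wu u1; rewrite /pml_objective.
have sumE : \sum_(1 <= i < n.+1) (v (t i) + (p (t i) - c)) =
    \sum_(1 <= i < n.+1) v (t i) + \sum_(1 <= i < n.+1) p (t i) - n%:R * c.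
  by rewrite big_split/= sumrB sumr_const_nat subn1 mulr_natl addrA.
rewrite sumE.
have LA : Linfty01 (fun x => v x - w x) by apply: Linfty01D => //; exact: LN.
set A := \int[mu]_(x in `[0, 1]) (v x - w x).
pose E0 x := beta ^+ 2 * (v x - w x) ^+ 2 + dv x ^+ 2.
have LE0 : Linfty01 E0.
  by apply: Linfty01D; [apply: Linfty01M => //|]; apply: Linfty01M.
pose E1 x := beta ^+ 2 * ((v x - w x) * p x) + dv x * r x.
have LE1 : Linfty01 E1.
  by apply: Linfty01D; [apply: Linfty01M => //|]; apply: Linfty01M.
have LAp : Linfty01 (fun x => (v x - w x) * p x) by exact: Linfty01M.
have intE1 : \int[mu]_(x in `[0, 1]) E1 x =
    beta ^+ 2 * \int[mu]_(x in `[0, 1]) ((v x - w x) * p x) +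
    \int[mu]_(x in `[0, 1]) (dv x * r x).
  by rewrite Rintegral01D ?Rintegral01Z//; exact: Linfty01M.
have intq : \int[mu]_(x in `[0, 1])
       ((beta ^+ 2 * (v x - w x) + gamma * expR (v x)) * p x) =
    beta ^+ 2 * \int[mu]_(x in `[0, 1]) ((v x - w x) * p x) + gamma * m.
  have -> : \int[mu]_(x in `[0, 1])
       ((beta ^+ 2 * (v x - w x) + gamma * expR (v x)) * p x) =
     \int[mu]_(x in `[0, 1])
       (beta ^+ 2 * ((v x - w x) * p x) + gamma * (expR (v x) * p x)).
    by apply: eq_Rintegral => x _; ring.
  rewrite Rintegral01D; [|exact: Linfty01M|].
    by rewrite !Rintegral01Z//; exact: Linfty01M.
  by apply: Linfty01M => //; exact: Linfty01M.
set D := \int[mu]_(x in `[0, 1]) (dv x * r x) in intE1 *.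
set B := \int[mu]_(x in `[0, 1]) ((v x - w x) * p x) in intq intE1.
(* Both squares are expanded; only (p - c)^2 <= 9 K^2 and r^2 <= K^2 are estimated. *)
have uE : \int[mu]_(x in `[0, 1])
      (beta ^+ 2 * (v x + (p x - c) - w x) ^+ 2 + (dv x + r x) ^+ 2) <=
    \int[mu]_(x in `[0, 1]) E0 x + 2 * \int[mu]_(x in `[0, 1]) E1 x +
    - (2 * beta ^+ 2 * c) * A + (9 * beta ^+ 2 + 1) * K ^+ 2.
  have intE2 : \int[mu]_(x in `[0, 1]) (E0 x + 2 * E1 x +
       - (2 * beta ^+ 2 * c) * (v x - w x) + (9 * beta ^+ 2 + 1) * K ^+ 2) =
    \int[mu]_(x in `[0, 1]) E0 x + 2 * \int[mu]_(x in `[0, 1]) E1 x +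
    - (2 * beta ^+ 2 * c) * A + (9 * beta ^+ 2 + 1) * K ^+ 2.
    have LE1' : Linfty01 (fun x => 2 * E1 x) by exact: Linfty01M.
    have LA' : Linfty01 (fun x => - (2 * beta ^+ 2 * c) * (v x - w x)) by exact: Linfty01M.
    have LE01 := Linfty01D LE0 LE1'.
    rewrite Rintegral01D//; last exact: Linfty01D.
    by rewrite Rintegral01D// Rintegral01D// !Rintegral01Z// Rintegral01_cst.
  rewrite -intE2; apply: le_Rintegral01.
  - by apply: Linfty01D; [apply: Linfty01M => //|]; apply: Linfty01M => //;
      repeat apply: Linfty01D => //; exact: LN.
  - by repeat apply: Linfty01D => //; apply: Linfty01M.
  move=> x x01; have := pK x x01; have := rK x x01; rewrite !ler_norml.
  move=> /andP[rl rh] /andP[pl ph]; rewrite /E0 /E1.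
  (* As K <= 1/2, -K <= c <= K + 2 K^2 <= 2 K, so |p - c| <= 3 K. *)
  have pc2 : (p x - c) ^+ 2 <= 9 * K ^+ 2.
    move: mK; rewrite ler_norml => /andP[ml mh].
    have K0 : 0 <= K by lra.
    have KK : 2 * K ^+ 2 <= K by rewrite expr2 mulrA ler_piMl//; lra.
    nra.
  have r2 : r x ^+ 2 <= K ^+ 2 by nra.
  have b2 : 0 <= beta ^+ 2 := sqr_ge0 beta.
  have : beta ^+ 2 * (p x - c) ^+ 2 <= beta ^+ 2 * (9 * K ^+ 2) by exact: ler_wpM2l.
  lra.
rewrite intq.
set S0 := \sum_(1 <= i < n.+1) v (t i); set S := \sum_(1 <= i < n.+1) p (t i).
move=> le_uv.
(* The sign of gamma is unknown, hence the absolute value against 0 <= c - m <= 2 K^2. *)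
have gc : gamma * c <= gamma * m + `|gamma| * (2 * K ^+ 2).
  rewrite -lerBlDl -mulrBr (le_trans (ler_norm _))// normrM ler_wpM2l//.
  by rewrite ger0_norm; lra.
have : 0 <= - (alpha^-1 * (S - n%:R * c)) + 2^-1 * (2 * \int[mu]_(x in `[0, 1]) E1 x +
    - (2 * beta ^+ 2 * c) * A + (9 * beta ^+ 2 + 1) * K ^+ 2).
  move: le_uv uE; rewrite -/E0; set J := \int[mu]_(x in _) (_ + _); lra.
rewrite intE1 gammaE /multiplier -/A in gc *.
lra.
Qed.
End euler_lagrange.

(** * The weak Euler-Lagrange equation, and ramps in weak form *)

Section weak_form.
Context {R : realType}.
Local Notation mu := (@lebesgue_measure R).
Implicit Types (v w psi f : R -> R) (alpha beta s x : R) (t : nat -> R).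

(** The perturbation is s times [prim psi], for small s of both signs, so the linear coefficient
    must vanish. [prim psi] is 0 at 0 but may be nonzero at 1, so the equation also carries boundary
    information. *)
Lemma pml_weak_euler_lagrange n t alpha beta w v psi :
  sample_grid n t -> {within `[0, 1], continuous w} ->
  pml_solution n t alpha beta w v -> test_function psi ->
  \int[mu]_(x in `[0, 1]) (v x * psi^`() x) =
  - (alpha^-1 * \sum_(1 <= i < n.+1) prim psi (t i)) +
  \int[mu]_(x in `[0, 1])
    ((beta ^+ 2 * (v x - w x) + multiplier n alpha beta w v * expR (v x)) *
     prim psi x).
Proof.
move=> gt cw [dv [Wv v1 vmin]] tpsi.
have [cpsi _ _ _ _] := test_functionP tpsi.
set q := fun x => beta ^+ 2 * (v x - w x) + multiplier n alpha beta w v * expR (v x).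
rewrite -/(q _).
have dphi x : is_derive x 1 (prim psi) (psi x) by exact: is_derive_prim_test.
have cphi := is_derive_continuous dphi.
have [M1 psiM] := continuous_bounded01 (continuous_subspaceT cpsi).
have [M2 phiM] := continuous_bounded01 (continuous_subspaceT cphi).
(* A positive common bound for psi and its primitive on [0, 1]. *)
pose M := Num.max M1 M2 + 1.
have M1M : M1 <= M by rewrite /M ler_wpDr// le_max lexx.
have M2M : M2 <= M by rewrite /M ler_wpDr// le_max lexx orbT.
have M0 : 0 < M.
  have /(le_trans (normr_ge0 _)) : `|psi 0| <= M1 by apply: psiM; rewrite lexx ler01.
  by rewrite /M => M10; rewrite ltr_wpDl// le_max M10.
rewrite (W1infty_weak_derivative Wv tpsi).
set D := \int[mu]_(x in _) (dv x * psi x).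
set S := \sum_(1 <= i < n.+1) _.
set B := \int[mu]_(x in _) _.
apply/esym/eqP; rewrite -subr_eq0 opprK; apply/eqP.
have [cv Lv Ldv _] := Wv.
have Lphi : Linfty01 (prim psi) by exact/continuous_Linfty01/continuous_subspaceT.
have Lpsi : Linfty01 psi by exact/continuous_Linfty01/continuous_subspaceT.
have Lq : Linfty01 q.
  apply: Linfty01D; apply: Linfty01M; try exact: Linfty01_cst.
    apply: Linfty01D => //; under eq_fun do rewrite -mulN1r.
    by apply: Linfty01M; [exact: Linfty01_cst|exact: continuous_Linfty01].
  apply/continuous_Linfty01 => x.
  by apply: continuous_comp; [exact: cv|exact: continuous_expR].
(* The perturbation has size K = |s| M, and |s| <= 1 / (2 M) ensures K <= 1/2. *)
apply: (@quadratic_ge0_linear0 _ _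
  ((2 * `|multiplier n alpha beta w v| + 2^-1 * (9 * beta ^+ 2 + 1)) * M ^+ 2)
  (2^-1 / M)) => [|s sM].
  by rewrite divr_gt0.
have sM2 : `|s| * M <= 2^-1 by rewrite -ler_pdivlMr.
have csp : continuous (fun x => s * psi x).
  by move=> x; apply: cvgM; [exact: cvg_cst|exact: cpsi].
have dsp x : is_derive x 1 (fun x => s * prim psi x) (s * psi x).
  by have := dphi x => ?; apply: is_deriveZ.
have := pml_perturbation gt cw Wv v1 vmin csp dsp sM2 _ _ erefl.
rewrite -mulr_sumr -/S.
have -> : \int[mu]_(x in `[0, 1]) (q x * (s * prim psi x)) = s * B.
  rewrite -Rintegral01Z; last exact: Linfty01M.
  by apply: eq_Rintegral => x _; rewrite mulrCA.
have -> : \int[mu]_(x in `[0, 1]) (dv x * (s * psi x)) = s * D.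
  rewrite -Rintegral01Z; last exact: Linfty01M.
  by apply: eq_Rintegral => x _; rewrite mulrCA.
rewrite exprMn real_normK ?num_real// => h.
rewrite [leRHS](_ : _ = - (alpha^-1 * (s * S)) + s * B + s * D +
  (2 * `|multiplier n alpha beta w v| + 2^-1 * (9 * beta ^+ 2 + 1)) *
  (s ^+ 2 * M ^+ 2)); last by ring.
apply: h => x x01; rewrite normrM ler_wpM2l//.
  by rewrite (le_trans (phiM x x01)).
by rewrite (le_trans (psiM x x01)).
Qed.

(** Composing with this retraction extends a function continuous on [0, 1] to one continuous on the
    line. *)
Definition clamp01 x : R := Num.max 0 (Num.min 1 x).

Lemma clamp01_id x : 0 <= x <= 1 -> clamp01 x = x.
Proof. by move=> /andP[x0 x1]; rewrite /clamp01 (min_idPr x1) (max_idPr x0). Qed.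

Lemma clamp01_itv x : 0 <= clamp01 x <= 1.
Proof.
by rewrite /clamp01 le_max lexx/= ge_max ler01 ge_min lexx.
Qed.

Lemma continuous_clamp01 f : {within `[0, 1], continuous f} ->
  continuous (f \o clamp01).
Proof.
have cclamp : continuous clamp01.
  move=> x; apply: (@continuous_max R R (cst 0) (fun x => Num.min 1 x)).
    exact: cvg_cst.
  by apply: (@continuous_min R R (cst 1) id); [exact: cvg_cst|exact: cvg_id].
move=> /subspace_continuousP cf x.
have clampI y : `[0, 1]%classic (clamp01 y) by rewrite /= in_itv/= clamp01_itv.
apply: (cvg_comp clamp01 f _ (cf _ (clampI x))) => A wA.
have : nbhs x (fun y => A (clamp01 y)); last by [].
by apply: (@filterS _ (nbhs x)) (cclamp x _ wA) => y /=; apply; exact: clampI.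
Qed.

(** The ramp vanishes left of s. On [[s, 1]] integration by parts leaves minus the integral of psi,
    since the ramp is 0 at s and psi is 0 at 1. *)
Lemma Rintegral_ramp s psi : 0 <= s < 1 -> test_function psi ->
  \int[mu]_(x in `[0, 1]) (Num.max 0 (x - s) * psi^`() x) =
  prim psi s - prim psi 1.
Proof.
move=> /andP[s0 s1] tpsi.
have [cpsi cdpsi dpsi psil psir] := test_functionP tpsi.
pose g x := Num.max 0 (x - s) * psi^`() x.
have cg : continuous g.
  move=> x; apply: cvgM; last exact: cdpsi.
  apply: (@continuous_max R R (cst 0) (fun x => x - s)).
    exact: cvg_cst.
  by apply: cvgB; [exact: cvg_id|exact: cvg_cst].
have -> : \int[mu]_(x in `[0, 1]) g x = \int[mu]_(x in `[s, 1]) g x.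
  rewrite !Rintegral_prim ?ltrN10//; last by rewrite (lt_le_trans _ s0) ?ltrN10.
  congr (_ - _); move: s0; rewrite le_eqVlt => /predU1P[->//|s0].
  apply/eqP; rewrite eq_sym -subr_eq0 -Rintegral_prim ?ltrN10//; apply/eqP.
  rewrite (@eq_Rintegral _ _ _ mu _ (cst 0)) ?Rintegral_cst ?mul0r//.
  move=> x /set_mem/=; rewrite in_itv/= => /andP[_ xs].
  by rewrite /g (max_idPl _) ?mul0r// subr_le0.
have -> : \int[mu]_(x in `[s, 1]) g x =
    \int[mu]_(x in `[s, 1]) ((x - s) * psi^`() x).
  apply: eq_Rintegral => x /set_mem/=; rewrite in_itv/= => /andP[sx _].
  by rewrite /g (max_idPr _)// subr_ge0.
have dshift x : is_derive x 1 (fun x => x - s) (cst 1 x).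
  by apply: is_derive_eq; rewrite subr0.
have c1 : {within `[s, 1], continuous (cst (1 : R))}.
  by apply: continuous_subspaceT => x; exact: cvg_cst.
have cdpsis : {within `[s, 1], continuous psi^`()} by exact: continuous_subspaceT.
rewrite (Rintegral_is_derive_by_parts s1 c1 cdpsis (fun x _ => dshift x) (fun x _ => dpsi x)).
rewrite subrr mul0r psir// mulr0 subrr sub0r.
under eq_Rintegral do rewrite /= mul1r.
by rewrite Rintegral_prim ?opprB// (lt_le_trans _ s0) ?ltrN10.
Qed.

End weak_form.

(** * Identification of the minimizer with an explicit primitive minus ramps *)

Section boundary_value_problem.
Context {R : realType}.
Local Notation mu := (@lebesgue_measure R).
Implicit Types (v w psi f P Q q : R -> R) (alpha beta k s x : R) (t : nat -> R).

Lemma Rintegral01_sum (I : Type) (r : seq I) (f : I -> R -> R) :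
  (forall i, Linfty01 (f i)) ->
  Linfty01 (fun x => \sum_(i <- r) f i x) /\
  \int[mu]_(x in `[0, 1]) (\sum_(i <- r) f i x) =
  \sum_(i <- r) \int[mu]_(x in `[0, 1]) f i x.
Proof.
move=> Lf; elim: r => [|i r [Lr IH]].
  rewrite (_ : (fun x => \sum_(i <- [::]) f i x) = fun=> 0); last first.
    by apply/funext => x; rewrite big_nil.
  by rewrite big_nil Rintegral01_cst; split => //; exact: Linfty01_cst.
rewrite (_ : (fun x => \sum_(j <- i :: r) f j x) =
  fun x => f i x + \sum_(j <- r) f j x); last first.
  by apply/funext => x; rewrite big_cons.
by rewrite big_cons Rintegral01D// IH; split => //; exact: Linfty01D.
Qed.

Lemma pml_solution_primitive n t alpha beta w v : alpha != 0 ->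
  sample_grid n t -> {within `[0, 1], continuous w} ->
  pml_solution n t alpha beta w v ->
  let gamma := multiplier n alpha beta w v in
  exists P Q q : R -> R, exists k : R,
  [/\ continuous q, forall x, 0 <= x <= 1 -> is_derive x 1 Q (q x),
      forall x, 0 <= x <= 1 -> is_derive x 1 P (Q x),
      Q 0 = 0 & Q 1 = n%:R / alpha] /\
  (forall x, 0 <= x <= 1 ->
    q x = beta ^+ 2 * (v x - w x) + gamma * expR (v x) /\
    v x = P x - alpha^-1 * \sum_(1 <= i < n.+1) Num.max 0 (x - t i) + k).
Proof.
move=> alpha0 gt cw vsol gamma.
have [dv [Wv v1 _]] := vsol; have [cv Lv _ _] := Wv.
pose vc := v \o clamp01; pose wc := w \o clamp01.
have cvc : continuous vc by exact: continuous_clamp01.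
have cwc : continuous wc by exact: continuous_clamp01.
have cevc : continuous (fun x => expR (vc x)).
  by move=> x; apply: continuous_comp; [exact: cvc|exact: continuous_expR].
pose q x := beta ^+ 2 * (vc x - wc x) + gamma * expR (vc x).
have qE x : 0 <= x <= 1 -> q x = beta ^+ 2 * (v x - w x) + gamma * expR (v x).
  by move=> x01; rewrite /q /vc /wc /= clamp01_id.
have cq : continuous q.
  move=> x; apply: cvgD; apply: cvgM; try exact: cvg_cst.
    by apply: cvgB; [exact: cvc|exact: cwc].
  exact: cevc.
have cqs : {within `[0, 1], continuous q} by exact: continuous_subspaceT.
pose Q x := prim q x - prim q 0.
have Q0 : Q 0 = 0 by rewrite /Q subrr.
have ltN01 x : 0 <= x <= 1 -> -1 < x.
  by move=> /andP[x0 _]; rewrite (lt_le_trans _ x0) ?ltrN10.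
have dQ x : 0 <= x <= 1 -> is_derive x 1 Q (q x).
  by move=> /ltN01 x1; have := is_derive_prim cq x1 => ?; apply: is_derive_eq; rewrite subr0.
have LA : Linfty01 (fun x => v x - w x).
  apply: Linfty01D => //; under eq_fun do rewrite -mulN1r.
  by apply: Linfty01M; [exact: Linfty01_cst|exact: continuous_Linfty01].
have Lev : Linfty01 (fun x => expR (v x)).
  by apply/continuous_Linfty01 => x; apply: continuous_comp; [exact: cv|exact: continuous_expR].
(* Because e^v integrates to 1, q integrates to beta^2 A + gamma, and gamma was chosen to make this
   n / alpha. *)
have Q1 : Q 1 = n%:R / alpha.
  rewrite /Q -Rintegral_prim ?ltrN10//.
  rewrite (@eq_Rintegral _ _ _ mu _
    (fun x => beta ^+ 2 * (v x - w x) + gamma * expR (v x))); last first.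
    by move=> x /set_mem/=; rewrite in_itv/= => /qE.
  rewrite Rintegral01D; [|by apply: Linfty01M => //; exact: Linfty01_cst..].
  by rewrite !Rintegral01Z// v1 mulr1 /gamma /multiplier addrC subrK.
(* Clamping is needed because [is_derive_prim] asks for a function continuous on the whole line. *)
pose P := prim (Q \o clamp01).
have cQ : {within `[0, 1], continuous Q}.
  exact: is_derive_within_continuous dQ.
have dP x : 0 <= x <= 1 -> is_derive x 1 P (Q x).
  move=> x01; rewrite -(clamp01_id x01) -[Q _]/((Q \o clamp01) x).
  rewrite {1}clamp01_id//; apply: is_derive_prim (ltN01 x x01).
  exact: continuous_clamp01.
have cPc : continuous (P \o clamp01).
  exact/continuous_clamp01/(is_derive_within_continuous dP).
pose ramp i x := Num.max 0 (x - t i).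
have cramp i : continuous (ramp i).
  move=> x; apply: (@continuous_max R R (cst 0) (fun x => x - t i)).
    exact: cvg_cst.
  by apply: cvgB; [exact: cvg_id|exact: cvg_cst].
pose V x := (P \o clamp01) x - alpha^-1 * \sum_(1 <= i < n.+1) ramp i x.
have cV : continuous V.
  move=> x; apply: cvgB; first exact: cPc.
  apply: cvgM; first exact: cvg_cst.
  by apply: cvg_big => [|i _]; [exact: add_continuous|exact: cramp].
pose f x := vc x - V x.
have cf : continuous f by move=> x; apply: cvgB; [exact: cvc|exact: cV].
have f0 psi : test_function psi ->
    \int[mu]_(x in `[0, 1]) (f x * psi^`() x) = 0.
  move=> tpsi; have [cpsi cdpsi dpsi psil psir] := test_functionP tpsi.
  have Lc g : continuous g -> Linfty01 g.
    by move=> cg; exact/continuous_Linfty01/continuous_subspaceT.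
  have Lram i : Linfty01 (fun x => ramp i x * psi^`() x).
    by apply: Linfty01M; exact: Lc.
  have [Lsum intsum] := @Rintegral01_sum _ (index_iota 1 n.+1) _ Lram.
  have dphi x : is_derive x 1 (prim psi) (psi x) by exact: is_derive_prim_test.
  have cphi := is_derive_continuous dphi.
  have phi0 : prim psi 0 = 0 by rewrite prim_eq0.
  rewrite (@eq_Rintegral _ _ _ mu _ (fun x => v x * psi^`() x +
    (- 1 * (P x * psi^`() x) +
     alpha^-1 * \sum_(1 <= i < n.+1) (ramp i x * psi^`() x)))); last first.
    move=> x /set_mem/=; rewrite in_itv/= => x01.
    rewrite /f /V /vc /= clamp01_id// -mulr_suml; ring.
  have LP : Linfty01 P by exact/continuous_Linfty01/(is_derive_within_continuous dP).
  have LPpsi : Linfty01 (fun x => P x * psi^`() x).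
    by apply: Linfty01M => //; exact: Lc.
  have Lcst := @Linfty01_cst R.
  have L1 : Linfty01 (fun x => - 1 * (P x * psi^`() x)) by exact: Linfty01M.
  have L2 : Linfty01 (fun x => alpha^-1 *
      \sum_(1 <= i < n.+1) (ramp i x * psi^`() x)) by exact: Linfty01M.
  rewrite Rintegral01D; [|by apply: Linfty01M => //; exact: Lc|exact: Linfty01D].
  rewrite Rintegral01D// !Rintegral01Z// intsum.
  (* Two integrations by parts: psi vanishes at both ends in the first, while the second keeps the
     boundary term at 1. *)
  have -> : \int[mu]_(x in `[0, 1]) (P x * psi^`() x) =
      \int[mu]_(x in `[0, 1]) (q x * prim psi x) - Q 1 * prim psi 1.
    rewrite (Rintegral_is_derive_by_parts ltr01 cQ _ dP (fun x _ => dpsi x)); last first.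
      exact: continuous_subspaceT.
    rewrite (psil 0)// (psir 1)// !mulr0 subrr sub0r.
    rewrite (Rintegral_is_derive_by_parts ltr01 cqs _ dQ (fun x _ => dphi x)); last first.
      exact: continuous_subspaceT.
    by rewrite phi0 mulr0 subr0 opprB.
  rewrite (pml_weak_euler_lagrange gt cw vsol tpsi) -/gamma.
  rewrite [\int[mu]_(x in _) (_ * prim psi x)](@eq_Rintegral _ _ _ mu _
    (fun x => q x * prim psi x)); last first.
    by move=> x /set_mem/=; rewrite in_itv/= => /qE ->.
  have -> : \sum_(1 <= i < n.+1) \int[mu]_(x in `[0, 1]) (ramp i x * psi^`() x) =
      \sum_(1 <= i < n.+1) (prim psi (t i) - prim psi 1).
    apply: eq_big_nat => i /andP[i1 ilen]; apply: Rintegral_ramp => //.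
    have /andP[-> _] := sample_grid_itv gt (ltnW ilen).
    by have [_ <- _] := gt; apply: (sample_grid_homo gt).
  (* The integrals of q against [prim psi] and the sample values cancel; what is left is Q 1 - n /
     alpha times [prim psi 1], which is 0. *)
  rewrite sumrB sumr_const_nat subn1 -mulr_natl Q1 /=; field.
  exact: alpha0.
exists P, Q, q, (f 0); split; first by split.
move=> x x01; split; first exact: qE.
rewrite -(weak_derivative0_cst cf f0 x01) /f /V /vc /= clamp01_id//.
by rewrite addrC subrK.
Qed.

End boundary_value_problem.

(** * Derivatives and one-sided limits on each subinterval *)

Section pieces.
Context {R : realType}.
Implicit Types (v P Q q : R -> R) (a b c k s x : R) (t : nat -> R).

(** Only the first i ramps have started on this piece, and the next is still 0 at its right end, so
    the closed interval is allowed. *)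
Lemma sum_ramp n t i x : sample_grid n t -> (i <= n)%N -> t i <= x <= t i.+1 ->
  \sum_(1 <= j < n.+1) Num.max 0 (x - t j) =
  i%:R * x - \sum_(1 <= j < i.+1) t j.
Proof.
move=> gt ilen /andP[tix xti]; have h := sample_grid_homo gt.
rewrite (big_cat_nat _ (n := i.+1))//= [X in _ + X]big_nat_cond [X in _ + X]big1 ?addr0.
  rewrite (_ : i%:R * x = \sum_(1 <= j < i.+1) x); last first.
    by rewrite sumr_const_nat subn1 mulr_natl.
  rewrite -sumrB; apply: eq_big_nat => j /andP[j1 ji]; apply/max_idPr.
  rewrite subr_ge0 (le_trans _ tix)//; move: ji; rewrite ltnS leq_eqVlt.
  by move=> /predU1P[->//|ji]; rewrite ltW// h// leqW.
move=> j; rewrite andbT => /andP[ij jn]; apply/max_idPl.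
rewrite subr_le0 (le_trans xti)//; move: ij; rewrite leq_eqVlt.
by move=> /predU1P[->//|ij]; rewrite ltW// h// ltnW.
Qed.

Lemma is_derive_cvg_at P Q s : is_derive s 1 P (Q s) ->
  h^-1 * (P (s + h) - P s) @[h --> (0 : R)^'] --> Q s.
Proof.
move=> [dP <-]; have : h^-1 *: (P (h *: 1 + s) - P s) @[h --> (0 : R)^'] --> 'D_1 P s.
  exact: dP.
by under eq_fun do rewrite /GRing.scale/= mulr1 [_ + s]addrC.
Qed.

Lemma is_derive_piece v P Q a b c k s :
  (forall x, a < x < b -> v x = P x - c * x + k) ->
  (forall x, a < x < b -> is_derive x 1 P (Q x)) ->
  a < s < b -> is_derive s 1 v (Q s - c).
Proof.
move=> vE dP sab; have dPs := dP s sab.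
apply: (@near_eq_is_derive _ _ _ (fun x => P x - c * x + k)).
  near=> x; rewrite vE//; apply/andP; split; near: x.
    by apply: lt_nbhsr; case/andP: sab.
  by apply: lt_nbhsl; case/andP: sab.
by apply: is_derive_eq; rewrite addr0 scaler1.
Unshelve. all: by end_near. Qed.

Lemma derive1_piece v P Q q a b c k s :
  (forall x, a < x < b -> v x = P x - c * x + k) ->
  (forall x, a < x < b -> is_derive x 1 P (Q x)) ->
  (forall x, a < x < b -> is_derive x 1 Q (q x)) ->
  a < s < b -> v^`() s = Q s - c /\ is_derive s 1 v^`() (q s).
Proof.
move=> vE dP dQ sab; have dQs := dQ s sab.
have v'E x : a < x < b -> v^`() x = Q x - c.
  by move=> /(is_derive_piece vE dP) [_ <-]; rewrite derive1E.
split; first exact: v'E.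
apply: (@near_eq_is_derive _ _ _ (fun x => Q x - c)).
  near=> x; rewrite v'E//; apply/andP; split; near: x.
    by apply: lt_nbhsr; case/andP: sab.
  by apply: lt_nbhsl; case/andP: sab.
by apply: is_derive_eq; rewrite subr0.
Unshelve. all: by end_near. Qed.

(** Inside the interval the derivative of v is Q - c, and Q is continuous up to both endpoints. *)
Lemma derive1_piece_cvg v P Q q a b c k : a < b ->
  (forall x, a <= x <= b -> v x = P x - c * x + k) ->
  (forall x, a <= x <= b -> is_derive x 1 P (Q x)) ->
  (forall x, a <= x <= b -> is_derive x 1 Q (q x)) ->
  v^`() @ a^'+ --> Q a - c /\ v^`() @ b^'- --> Q b - c.
Proof.
move=> ab vE dP dQ.
have oo x : a < x < b -> a <= x <= b by move=> /andP[/ltW-> /ltW->].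
have v'E x : a < x < b -> v^`() x = Q x - c.
  by case/(derive1_piece (fun y y_ => vE y (oo y y_)) (fun y y_ => dP y (oo y y_))
    (fun y y_ => dQ y (oo y y_))).
have cQ s : a <= s <= b -> Q x - c @[x --> s] --> Q s - c.
  move=> /dQ [/derivable1_diffP/differentiable_continuous cQ _].
  by apply: cvgB; [exact: cQ|exact: cvg_cst].
split.
  apply: cvg_trans (cvg_at_right_filter (cQ a _)); last by rewrite lexx ltW.
  apply: near_eq_cvg; near=> x; rewrite v'E//; apply/andP; split.
    by near: x; exact: nbhs_right_gt.
  by near: x; exact: nbhs_right_lt.
apply: cvg_trans (cvg_at_left_filter (cQ b _)); last by rewrite lexx ltW.
apply: near_eq_cvg; near=> x; rewrite v'E//; apply/andP; split.
  by near: x; exact: nbhs_left_gt.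
by near: x; exact: nbhs_left_lt.
Unshelve. all: by end_near. Qed.

End pieces.

(** * Verification of the boundary value problem *)

Unset Implicit Arguments.
Set Strict Implicit.

Theorem theorem1 (R : realType) (n : nat) (t : nat -> R) (alpha beta : R)
    (w v : R -> R) (n_ge1 : (1 <= n)%N) (t_grid : sample_grid n t)
    (alpha_gt0 : 0 < alpha) (w_cont : {within `[0, 1], continuous w})
    (v_sol : pml_solution n t alpha beta w v) :
  exists (gamma : R) (z : R -> R), bvp_solution n t alpha beta w v z gamma.
Proof.
have [P [Q [q [k [[_ dQ dP Q0 Q1] qv]]]]] :=
  pml_solution_primitive (lt0r_neq0 alpha_gt0) t_grid w_cont v_sol.
have [dv [[v_cont _ _ _] v1 _]] := v_sol.
have [t0 t1 tS] := t_grid.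
have t01 i x : (i <= n)%N -> t i <= x <= t i.+1 -> 0 <= x <= 1.
  move=> ilen /andP[ix xi].
  have /andP[ti0 _] := sample_grid_itv t_grid (leqW ilen).
  have /andP[_ ti1] := @sample_grid_itv R n t i.+1 t_grid ilen.
  by rewrite (le_trans ti0)//= (le_trans xi).
have t01oo i x : t i < x < t i.+1 -> t i <= x <= t i.+1.
  by move=> /andP[/ltW-> /ltW->].
pose a := alpha^-1.
(* On the i-th piece the active ramps contribute slope - i / alpha, and their offsets go into the
   constant. *)
have piece i : (i <= n)%N -> exists ki, forall x, t i <= x <= t i.+1 ->
    v x = P x - i%:R * a * x + ki.
  move=> ilen; exists (k + a * \sum_(1 <= j < i.+1) t j) => x xi.
  have [_ ->] := qv x (t01 i x ilen xi).
  by rewrite (sum_ramp t_grid ilen xi) -/a; ring.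
have limits i : (i <= n)%N ->
    v^`() @ (t i)^'+ --> Q (t i) - i%:R * a /\
    v^`() @ (t i.+1)^'- --> Q (t i.+1) - i%:R * a.
  move=> ilen; have [ki vE] := piece i ilen.
  apply: (derive1_piece_cvg (tS i ilen) vE (q := q)) => x /(t01 i x ilen).
    exact: dP.
  exact: dQ.
have ev_cont : continuous (fun x => expR ((v \o clamp01) x)).
  by move=> x; apply: continuous_comp;
    [exact: continuous_clamp01|exact: continuous_expR].
pose ez := prim (fun x => expR ((v \o clamp01) x)).
exists (multiplier n alpha beta w v), (fun x => ez x - ez 0).
have dez (x : R) : 0 <= x <= 1 -> is_derive x 1 (fun x => ez x - ez 0) (expR (v x)).
  move=> x01; have : is_derive x 1 ez (expR (v x)).
    rewrite -[in expR _](clamp01_id x01); apply: is_derive_prim => //.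
    by case/andP: x01 => x0 _; rewrite (lt_le_trans _ x0) ?ltrN10.
  by move=> ?; apply: is_derive_eq; rewrite subr0.
split=> //.
- exact: is_derive_within_continuous dez.
- by move=> i /limits[lp lm]; split; apply/cvg_ex;
    [exists (Q (t i) - i%:R * a)|exists (Q (t i.+1) - i%:R * a)].
- move=> i ilen s si; have [d <-] := dez s (t01 i s ilen (t01oo i s si)).
  by rewrite derive1E.
- move=> i ilen s si; have si' := t01oo i s si.
  have [ki vE] := piece i ilen.
  have vE' x (xi : t i < x < t i.+1) := vE x (t01oo i x xi).
  have dP' x (xi : t i < x < t i.+1) := dP x (t01 i x ilen (t01oo i x xi)).
  have dQ' x (xi : t i < x < t i.+1) := dQ x (t01 i x ilen (t01oo i x xi)).
  have [dvs _] := is_derive_piece vE' dP' si.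
  have [_ [ddvs ddvE]] := derive1_piece vE' dP' dQ' si.
  split=> //; rewrite derive1nS derive1n1 derive1E ddvE.
  by have [-> _] := qv s (t01 i s ilen si').
- exact: subrr.
- rewrite -Rintegral_prim ?ltrN10// -[RHS]v1.
  apply: eq_Rintegral => x /set_mem/=; rewrite in_itv/= => x01.
  by rewrite clamp01_id.
(* No ramp is active on the first piece, so the quotient of v at 0 is that of P, with limit Q 0 =
   0. *)
- have [k0 vE] := piece 0%N isT.
  have dP0 : is_derive (0 : R) 1 P (Q 0) by apply: dP; rewrite lexx ler01.
  have := cvg_dnbhs_at_right (is_derive_cvg_at dP0); rewrite Q0.
  apply: cvg_trans; apply: near_eq_cvg; near=> h; rewrite add0r !vE.
  + by ring.
  + by rewrite t0 lexx -t0 ltW// tS.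
  + rewrite t0; apply/andP; split; near: h; first exact: nbhs_right_ge.
    by apply: nbhs_right_le; rewrite -t0 tS.
(* On the last piece all n ramps are active; their slope n / alpha equals Q 1 and cancels the
   derivative of P at 1. *)
- have [kn vE] := piece n (leqnn n).
  have dP1 : is_derive (1 : R) 1 P (Q 1) by apply: dP; rewrite lexx ler01.
  have : h^-1 * (P (1 + h) - P 1) - Q 1 @[h --> (0 : R)^'-] --> Q 1 - Q 1.
    by apply: cvgB (cvg_cst _); exact: cvg_dnbhs_at_left (is_derive_cvg_at dP1).
  rewrite subrr; apply: cvg_trans; apply: near_eq_cvg; near=> h.
  have h0 : h != 0.
    by rewrite lt_eqF//; near: h; exact: nbhs_left_lt.
  rewrite !vE ?Q1 /a.
  + by field; rewrite h0 gt_eqF.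
  + by rewrite t1 lexx -t1 ltW// tS.
  + rewrite t1; apply/andP; split.
      rewrite -lerBlDl; near: h; apply: nbhs_left_ge.
      by rewrite subr_lt0 -t1 tS.
    by rewrite gerDl; near: h; exact: nbhs_left_le.
(* The sample point has index j + 1: piece j + 1 gives the right limit and piece j the left one. The
   values of Q agree and the slopes differ by 1 / alpha. *)
- move=> [//|j] /andP[_ jn]; have [lp _] := limits j.+1 jn.
  have [_ lm] := limits j (ltnW jn).
  rewrite (cvg_lim _ lp)// (cvg_lim _ lm)//.
  by rewrite -natr1 -/a; ring.
Unshelve. all: by end_near. Qed.
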